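(* Let $A\in\mathbb{R}^{n\times n}$ be symmetric and let $f$ be a real function defined on the spectrum of $A$ such that $f(A)$ is nonzero. Let $d\ge1$ be an integer, let a distance-$d$ coloring $C_1,\dots,C_m$ of $\mathcal{G}(A)$ be given, let $\mathcal{N}=(N_1,\dots,N_m)$ be a tuple of positive integers, and for $\ell=1,\dots,m$, $s=1,\dots,N_\ell$ let $\boldsymbol{w}_\ell^{(s)}$ be Rademacher probing vectors associated with $C_\ell$, all of them (over all $\ell$ and $s$) being independent. Let $$\mathcal{T}_d^{\mathcal{N}}(f(A))=\sum_{\ell=1}^m\frac1{N_\ell}\sum_{s=1}^{N_\ell}(\boldsymbol{w}_\ell^{(s)})^Tf(A)\boldsymbol{w}_\ell^{(s)}.$$ Then for every $\varepsilon>0$ $$\mathbb{P}\left(|\operatorname{tr}(f(A))-\mathcal{T}_d^{\mathcal{N}}(f(A))|\ge\varepsilon\right)\le 2\exp\left(-\frac{\varepsilon^2}{8\eta_1+8\varepsilon\eta_2}\right),$$ where $$\eta_1:=\sum_{\ell=1}^m\frac1{N_\ell}\|\operatorname{Off}([f(A)]_{C_\ell})\|_F^2,\qquad \eta_2:=\max_{\ell=1,\dots,m}\frac1{N_\ell}\|\operatorname{Off}([f(A)]_{C_\ell})\|_2$$ (the right-hand side of the bound being read as $0$ if $\eta_1=\eta_2=0$). In particular, for $\delta\in(0,1)$, if $N_1,\dots,N_m$ are chosen such that $$\eta_1+\varepsilon\eta_2\le\frac{\varepsilon^2}{8\log\frac2\delta},$$ then $\mathbb{P}\left(|\operatorname{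tr}(f(A))-\mathcal{T}_d^{\mathcal{N}}(f(A))|\ge\varepsilon\right)\le\delta$.
   Context: For symmetric $A$, $f(A)$ is the matrix function defined through the spectral decomposition. $[M]_{ij}$ is the $(i,j)$ entry of $M$, $[M]_{\mathcal{I}}$ is the submatrix of $M$ with rows and columns indexed by $\mathcal{I}$, $\operatorname{Off}(M)$ is the off-diagonal part of $M$ (diagonal replaced by zeros), $\|\cdot\|_F$ is the Frobenius norm and $\|\cdot\|_2$ the spectral norm. $\mathcal{G}(A)=(V,E)$ is the undirected graph with $V=\{1,\dots,n\}$ and $E=\{(i,j): i\ne j,\ [A]_{ij}\ne 0\}$; $\mathrm{d}(i,j)$ is the geodesic (shortest path) distance in $\mathcal{G}(A)$ ($\infty$ if there is no path). A distance-$d$ coloring with $m$ colors is a partition of $V$ of the form $C_\ell=\{i:\operatorname{col}(i)=\ell\}$, $\ell=1,\dots,m$, for a map $\operatorname{col}:V\to\{1,\dots,m\}$ satisfying $\operatorname{col}(i)\ne\operatorname{col}(j)$ whenever $i\ne j$ and $\mathrm{d}(i,j)\le d$. A Rademacher probing vector associated with $C_\ell$ is a random vector $\sum_{i\in C_\ell}X_i\boldsymbol{e}_i\in\mathbb{R}^n$, where $\boldsymbol{e}_i$ is the $i$th canonical basis vector and the $X_i$ are i.i.d. taking the values $\pm1$ with probability $\tfrac12$ each. *)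

(* Defs.v *)
From HB Require Import structures.
From mathcomp Require Import all_boot all_order all_algebra.
From mathcomp Require Import complex.
From mathcomp Require Import all_classical all_reals all_analysis.

Set Implicit Arguments.
Unset Strict Implicit.
Unset Printing Implicit Defensive.

Import Order.TTheory GRing.Theory Num.Theory.
Import numFieldNormedType.Exports.

Local Open Scope classical_set_scope.
Local Open Scope ring_scope.

Definition spectral_decomposition (R : realType) (n : nat)
    (A U : 'M[R]_n) (lam : 'rV[R]_n) : Prop :=
  U *m U^T = 1%:M /\ A = U *m diag_mx lam *m U^T.

(* For symmetric [A] a spectral decomposition exists and the value does not
   depend on which one is used: see [ex_spectral_decomposition] and [matfunE].
   The default value 0 is only returned when [A] is not symmetric. *)
Definition matfun (R : realType) (n : nat) (f : R -> R) (A : 'M[R]_n) :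
    'M[R]_n :=
  xget 0 [set F | exists U lam, spectral_decomposition A U lam /\
                  F = U *m diag_mx (map_mx f lam) *m U^T].

Lemma matfunE (R : realType) (n : nat) (f : R -> R) (A U : 'M[R]_n)
    (lam : 'rV[R]_n) :
  spectral_decomposition A U lam ->
  matfun f A = U *m diag_mx (map_mx f lam) *m U^T.
Proof.
move=> [UU AU]; rewrite /matfun.
have UU' := mulmx1C UU.
case: xgetP => [F _ /= [V [mu [[VV AV] ->]]]|]; last first.
  by move=> /(_ (U *m diag_mx (map_mx f lam) *m U^T)) []; exists U, lam.
have VV' := mulmx1C VV.
pose W := V^T *m U.
have WE : diag_mx mu *m W = W *m diag_mx lam.
  have := AV; rewrite AU => /(congr1 (fun X => V^T *m X *m U)).
  by rewrite /W !mulmxA VV' mul1mx -!mulmxA UU' mulmx1.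
have WfE : diag_mx (map_mx f mu) *m W = W *m diag_mx (map_mx f lam).
  apply/matrixP => i j; have /matrixP/(_ i j) := WE.
  rewrite !mul_diag_mx !mul_mx_diag !mxE mulrC.
  set z := \sum_k _.
  have [->|z0] := eqVneq z 0; first by rewrite !mulr0 !mul0r.
  by move=> /(mulfI z0) ->; rewrite mulrC.
move: WfE; rewrite /W => /(congr1 (fun X => V *m X *m U^T)).
rewrite -!mulmxA UU mulmx1 => ->.
by rewrite !mulmxA VV mul1mx.
Qed.

Lemma symmetric_eigenvalue_embed (R : rcfType) (C : numClosedFieldType)
    (toC : {rmorphism R -> C}) (n : nat) (A : 'M[R]_n.+1) :
  (forall x, reflect (exists k, x = toC k) (x \is Num.real)) ->
  A^T = A -> exists a, eigenvalue A a.
Proof.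
move=> toCP Asym; pose B : 'M[C]_n.+1 := map_mx toC A.
have Breal : B \is a mxOver (Num.real : {pred C}).
  by apply/mxOverP => i j; rewrite mxE; apply/toCP; exists (A i j).
have Bh : B \is hermsymmx.
  apply: realsym_hermsym Breal.
  by apply/is_hermitianmxP; rewrite scale1r map_mx_id // /B map_trmx Asym.
have /orthomx_spectralP BE := hermitian_normalmx Bh.
have /mxOverP/(_ 0 0)/toCP[a ad] := hermitian_spectral_diag_real Bh.
exists a; rewrite eigenvalue_root_char -(fmorph_root toC) map_char_poly -eigenvalue_root_char.
apply/eigenvalueP.
set Q := spectralmx B in BE *.
exists (row 0 Q).
  rewrite -row_mul -/B [X in Q *m X]BE !mulmxA mulmxV ?spectral_unit// mul1mx.
  by rewrite mul_diag_mx; apply/rowP => j; rewrite !mxE ad.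
apply/negP => /eqP r0; have := spectral_unit B; rewrite -/Q unitmxE.
by rewrite (expand_det_row _ 0) big1 ?unitr0// => j _;
  move/rowP/(_ j): r0; rewrite !mxE => ->; rewrite mul0r.
Qed.

Lemma symmetric_eigenvalue (R : rcfType) (n : nat) (A : 'M[R]_n.+1) :
  A^T = A -> exists a, eigenvalue A a.
Proof.
apply: (@symmetric_eigenvalue_embed R (complex.complex R)
  (@complex.real_complex_def R (Phant R))).
exact: complex.complex_realP.
Qed.

Lemma ex_orthogonal_row0 (R : rcfType) (n : nat) (v : 'rV[R]_n.+1) :
  v *m v^T = 1%:M ->
  exists H : 'M[R]_n.+1, [/\ H^T = H, H *m H = 1%:M & row 0 H = v].
Proof.
move=> vv; pose e : 'rV[R]_n.+1 := delta_mx 0 0; pose u := e - v.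
have rowe (M : 'M[R]_n.+1) : row 0 M = e *m M by rewrite rowE.
have [u0|u0] := eqVneq u 0.
  exists 1%:M; rewrite trmx1 mulmx1 rowe mulmx1; split => //.
  by apply/eqP; rewrite -subr_eq0; apply/eqP.
have ee : e *m e^T = 1%:M.
  by rewrite /e trmx_delta mul_delta_mx; apply/matrixP => i j; rewrite !ord1 !mxE.
pose c := (u *m u^T) 0 0.
have uuE : u *m u^T = c%:M by rewrite [LHS]mx11_scalar.
have c0 : c != 0.
  apply: contraNneq u0 => c0; apply/eqP/rowP => j; rewrite [RHS]mxE.
  move: c0; rewrite /c mxE => /eqP; rewrite psumr_eq0.
    by move=> /allP/(_ j); rewrite mem_index_enum => /(_ isT); rewrite !mxE mulf_eq0 orbb => /eqP.
  by move=> i _; rewrite [u^T _ _]mxE -expr2 sqr_ge0.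
have eu : 2 *: (e *m u^T) = u *m u^T.
  have evT : e *m v^T = v *m e^T.
    by rewrite -[LHS]trmxK trmx_mul trmxK; apply/matrixP => i j; rewrite !ord1 mxE.
  rewrite /u linearB/= mulmxBl !mulmxBr ee vv evT scaler_nat mulr2n.
  by rewrite opprB.
have uE : u = e - v by [].
clearbody u.
exists (1%:M - (2 / c) *: (u^T *m u)); split.
- by rewrite linearB/= linearZ/= trmx1 trmx_mul trmxK.
- rewrite mulmxBl mul1mx mulmxBr mulmx1 -scalemxAl -scalemxAr -mulmxA (mulmxA u) uuE.
  rewrite mul_scalar_mx -scalemxAr scalerA mulfVK//.
  set X := (2 / c) *: (u^T *m u); have -> : (2 / c) *: (2 *: (u^T *m u)) = X + X.
    by rewrite scalerA mulrC -scalerA scaler_nat mulr2n.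
  by rewrite opprB addrK subrK.
- rewrite rowe mulmxBr mulmx1 -scalemxAr mulmxA mulrC -scalerA scalemxAl eu uuE.
  by rewrite mul_scalar_mx scalerA mulVf// scale1r uE opprB addrC subrK.
Qed.

Lemma ex_spectral_decomposition (R : realType) (n : nat) (A : 'M[R]_n) :
  A^T = A -> exists U lam, spectral_decomposition A U lam.
Proof.
elim: n A => [|n IHn] A Asym.
  by exists 1%:M, 0; split; apply/matrixP => -[].
have [a /eigenvalueP[v0 v0A v0_neq0]] := symmetric_eigenvalue Asym.
have s0 : 0 < (v0 *m v0^T) 0 0.
  rewrite lt_def mxE sumr_ge0 ?andbT => [|i _]; last by rewrite mxE -expr2 sqr_ge0.
  apply: contraNneq v0_neq0 => /eqP; rewrite psumr_eq0 => [/allP h|i _].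
    apply/eqP/rowP => j; have := h j; rewrite mem_index_enum => /(_ isT).
    by rewrite !mxE mulf_eq0 orbb => /eqP.
  by rewrite mxE -expr2 sqr_ge0.
set s := (_ *m _) 0 0 in s0.
pose v := (Num.sqrt s)^-1 *: v0.
have vv : v *m v^T = 1%:M.
  rewrite /v linearZ/= -scalemxAl -scalemxAr scalerA [v0 *m _]mx11_scalar -/s.
  by rewrite -invfM -expr2 sqr_sqrtr ?ltW// scale_scalar_mx mulVf ?gt_eqF.
have vA : v *m A = a *: v by rewrite /v -scalemxAl v0A !scalerA mulrC.
have [H [Hs HH Hv]] := ex_orthogonal_row0 vv.
pose B : 'M[R]_(1 + n) := H *m A *m H.
have Bs : B^T = B by rewrite /B !trmx_mul Asym Hs mulmxA.
have B0 : row 0 B = a *: delta_mx 0 0.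
  by rewrite /B !row_mul Hv vA -scalemxAl -Hv -row_mul HH rowE mulmx1.
have AE : A = H *m B *m H by rewrite /B !mulmxA HH mul1mx -mulmxA HH mulmx1.
clearbody B.
have Bul : ulsubmx B = a%:M.
  apply/matrixP => i j; rewrite !ord1 2![in LHS]mxE.
  move/rowP/(_ 0): B0; rewrite !mxE !eqxx mulr1 mulr1n => <-.
  by congr (B _ _); apply/val_inj.
have Bur : ursubmx B = 0.
  apply/matrixP => i j; rewrite !ord1 2![in LHS]mxE.
  move/rowP/(_ (rshift 1 j)): B0; rewrite [in LHS]mxE => Bj; rewrite [RHS]mxE.
  transitivity (B 0 (rshift 1 j)); first by congr (B _ _); apply/val_inj.
  by rewrite Bj mxE [in X in _ * X]mxE mulr0.
have Bdl : dlsubmx B = 0 by rewrite -[B]Bs -trmx_ursub Bur trmx0.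
have Bdr : (drsubmx B)^T = drsubmx B by rewrite trmx_drsub Bs.
have [V [mu [VV VB]]] := IHn _ Bdr.
pose W : 'M[R]_(1 + n) := block_mx 1%:M 0 0 V.
have WW : W *m W^T = 1%:M.
  rewrite /W tr_block_mx mulmx_block !trmx0 trmx1.
  rewrite !(mulmx0, mul0mx, addr0, add0r, mulmx1) VV.
  exact/esym/scalar_mx_block.
have WB : B = W *m diag_mx (row_mx a%:M mu) *m W^T.
  rewrite -[LHS]submxK Bul Bur Bdl VB /W tr_block_mx diag_mx_row !mulmx_block.
  rewrite !trmx0 trmx1 !(mulmx0, mul0mx, addr0, add0r, mulmx1, mul1mx).
  by congr block_mx; apply/matrixP => i j; rewrite !ord1 !mxE.
exists (H *m W), (row_mx a%:M mu); split; rewrite trmx_mul Hs.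
  by rewrite !mulmxA -(mulmxA H W) WW mulmx1.
by rewrite AE WB !mulmxA.
Qed.

Definition fnorm (R : realType) (m n : nat) (M : 'M[R]_(m, n)) : R :=
  Num.sqrt (\sum_i \sum_j M i j ^+ 2).

(* The operator norm induced by the Euclidean norm, which is [fnorm] on column
   vectors; the unit ball rather than the unit sphere, so that the set is
   nonempty when [n = 0] (the norm is then 0). *)
Definition specnorm (R : realType) (m n : nat) (M : 'M[R]_(m, n)) : R :=
  sup [set fnorm (M *m x) | x in [set x : 'cV[R]_n | fnorm x <= 1]].

Definition offdiag (R : realType) (n : nat) (M : 'M[R]_n) : 'M[R]_n :=
  \matrix_(i, j) (if i == j then 0 else M i j).

Definition principal_submx (R : realType) (n : nat) (M : 'M[R]_n)
    (I : {set 'I_n}) : 'M[R]_#|I| :=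
  mxsub enum_val enum_val M.

Definition mxgraph (R : realType) (n : nat) (A : 'M[R]_n) : rel 'I_n :=
  [rel i j | (i != j) && (A i j != 0)].

(* The infimum of the empty set is [+oo]: no path from [x] to [y]. *)
Definition geodist (R : realType) (V : finType) (e : rel V) (x y : V) :
    \bar R :=
  ereal_inf [set ((size p)%:R : R)%:E |
             p in [set p : seq V | path.path e x p /\ last x p = y]].

Definition distance_coloring (R : realType) (n m : nat) (A : 'M[R]_n) (d : nat)
    (col : 'I_n -> 'I_m) : Prop :=
  forall i j : 'I_n, i != j -> (geodist R (mxgraph A) i j <= (d%:R : R)%:E)%E ->
  col i != col j.

Definition color_class (n m : nat) (col : 'I_n -> 'I_m) (l : 'I_m) :
    {set 'I_n} :=
  [set i | col i == l]%SET.

(* Mutual independence of the systems of events [S k], [k] in [D]; random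
   elements are independent when the sigma-algebras they generate are. *)
Definition mutually_independent (R : realType) (dsp : measure_display)
    (T : measurableType dsp) (P : probability T R) (I : finType) (D : {set I})
    (S : I -> set (set T)) : Prop :=
  forall (J : {set I}) (E : I -> set T), J \subset D ->
    (forall k, k \in J -> S k (E k)) ->
    P (\bigcap_(k in [set` J]) E k) = (\prod_(k in J) P (E k))%E.

Definition sigma_rv (R : realType) (T : Type) (X : T -> R) : set (set T) :=
  preimage_set_system [set: T] X measurable.

Definition sigma_rvec (R : realType) (T : Type) (n : nat) (w : T -> 'cV[R]_n) :
    set (set T) :=
  <<s \bigcup_(i in [set: 'I_n]) sigma_rv (fun t => w t i 0) >>.

Definition rademacher (R : realType) (dsp : measure_display)
    (T : measurableType dsp) (P : probability T R) (X : {RV P >-> R}) : Prop :=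
  P [set t | X t = 1] = (2^-1)%:E /\ P [set t | X t = -1] = (2^-1)%:E.

Definition rademacher_probing (R : realType) (dsp : measure_display)
    (T : measurableType dsp) (P : probability T R) (n : nat) (C : {set 'I_n})
    (w : T -> 'cV[R]_n) : Prop :=
  exists X : 'I_n -> {RV P >-> R},
    [/\ forall i, i \in C -> rademacher (X i),
        mutually_independent P C (fun i => sigma_rv (X i))
      & forall t, w t = \sum_(i in C) X i t *: delta_mx i 0].

Definition probing_estimator (R : realType) (n m : nat) (N : 'I_m -> nat)
    (F : 'M[R]_n) (w : forall l : 'I_m, 'I_(N l) -> 'cV[R]_n) : R :=
  \sum_(l < m) (N l)%:R^-1 *
    \sum_(s < N l) ((w l s)^T *m F *m w l s) 0 0.

Definition eta1 (R : realType) (n m : nat) (N : 'I_m -> nat)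
    (col : 'I_n -> 'I_m) (F : 'M[R]_n) : R :=
  \sum_(l < m) (N l)%:R^-1 *
    fnorm (offdiag (principal_submx F (color_class col l))) ^+ 2.

(* All the terms are nonnegative, so the default value 0 is harmless. *)
Definition eta2 (R : realType) (n m : nat) (N : 'I_m -> nat)
    (col : 'I_n -> 'I_m) (F : 'M[R]_n) : R :=
  \big[Order.max/0]_(l < m) ((N l)%:R^-1 *
    specnorm (offdiag (principal_submx F (color_class col l)))).

(* When [eta1] and [eta2] vanish the quotient is read as [+oo], so the bound
   is 0; MathComp's [x / 0 = 0] would give 2 instead. *)
Definition tail_bound (R : realType) (eta1 eta2 eps : R) : R :=
  if (eta1 == 0) && (eta2 == 0) then 0
  else 2 * expR (- (eps ^+ 2 / (8 * eta1 + 8 * eps * eta2))).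

(* Main.v *)
(* On a probability-one event the error is the absolute value of a Rademacher
   chaos [Q = x^T B x], where the symmetric matrix [B] has zero diagonal and is
   block diagonal with one block [Off([F]_(C_l)) / N_l] per probing vector; thus
   [|B|_F^2 = eta1] and [|B|_2 = eta2].  The moment generating function
   [psi(c) = E exp(c Q)] is controlled by a Gibbs-measure argument.  With
   [y = B x], the sign [x_i] has conditional mean [tanh (2 c y_i)] under the
   weight [exp(c Q)], so [psi'(c) = E (sum_i y_i tanh (2 c y_i)) exp(c Q)
   <= 2 c M] with [M = E |y|^2 exp(c Q)].  Applying the same identity to
   [|y|^2 = x^T B y] gives [M <= |B|_F^2 psi(c) + 2 c |B|_2 M].  Hence
   [psi' <= 4 c |B|_F^2 psi] as long as [4 c |B|_2 <= 1], so that
   [psi(c) <= exp(2 c^2 |B|_F^2)] there, and Markov's inequality with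
   [c = eps / (4 eta1 + 4 eps eta2)] yields the bound for each tail. *)
Require Import Defs.
From HB Require Import structures.
From mathcomp Require Import all_boot all_order all_algebra.
From mathcomp Require Import all_classical all_reals all_analysis.
From mathcomp Require Import measurable_realfun.
From mathcomp Require Import ring lra.
Import Order.TTheory GRing.Theory Num.Theory.
Import numFieldNormedType.Exports.
Local Open Scope classical_set_scope.
Local Open Scope ring_scope.

(** * Bounds on the hyperbolic tangent *)

Lemma ge0_is_derive_le (R : realType) (f f' : R -> R) (b : R) :
  (forall x : R, is_derive x (1 : R) f (f' x)) ->
  (forall x, 0 < x < b -> 0 <= f' x) -> 0 <= b -> f 0 <= f b.
Proof.
move=> fd f'0 b0.
have df x : derivable f x 1 by have [] := fd x.
apply: (@ger0_derive1_le_cc R f 0 b) => //.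
- by move=> x; rewrite in_itv/= => xb; rewrite derive1E derive_val f'0.
- by apply: derivable_within_continuous => x _.
- by rewrite in_itv/= lexx b0.
- by rewrite in_itv/= lexx b0.
Qed.

Definition tanh {R : realType} (a : R) : R :=
  (expR a - expR (- a)) / (expR a + expR (- a)).

Lemma tanhN (R : realType) (a : R) : tanh (- a) = - tanh a.
Proof. by rewrite /tanh opprK [X in _ / X = _]addrC -mulNr opprB. Qed.

(** The form in which [tanh] enters: the signs 1 and -1 with weights [expR a] and [expR (- a)] have
    mean [tanh a], because the weighted deviations from it cancel. *)
Lemma tanh_eq (R : realType) (a : R) :
  (1 - tanh a) * expR a = (1 + tanh a) * expR (- a).
Proof.
rewrite /tanh; have h : expR a + expR (- a) != 0.
  by rewrite gt_eqF// addr_gt0 ?expR_gt0.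
by field.
Qed.

Lemma tanh_ge0 (R : realType) (a : R) : 0 <= a -> 0 <= tanh a.
Proof.
move=> a0; apply: divr_ge0; last by rewrite addr_ge0 ?expR_ge0.
rewrite subr_ge0 ler_expR.
by rewrite (le_trans _ a0)// oppr_le0.
Qed.

Lemma tanh_le (R : realType) (a : R) : 0 <= a -> tanh a <= a.
Proof.
move=> a0; rewrite ler_pdivrMr ?addr_gt0 ?expR_gt0// -subr_ge0.
(* Clearing the denominator leaves [f], whose derivative collapses to
   [x * (expR x - expR (- x))]. *)
pose f (x : R) := x * (expR x + expR (- x)) - (expR x - expR (- x)).
have <- : f 0 = 0 by rewrite /f oppr0 subrr mul0r subrr.
apply: (@ge0_is_derive_le _ f (fun x => x * (expR x - expR (- x)))) => // x.
  have := is_derive_expR x => d1.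
  have d2 : is_derive x 1 (fun y : R => expR (- y)) (- expR (- x)).
    have := @is_derive1_comp R expR -%R x (expR (- x)) (-1).
    by move=> h; apply: is_derive_eq; rewrite ?mulrN1 ?scalerN1 ?mulN1r.
  rewrite /f; apply: is_derive_eq.
  by rewrite /GRing.scale/=; ring.
move=> /andP[x0 _]; rewrite mulr_ge0 ?ltW// subr_gt0 ltr_expR.
by rewrite gtrN.
Qed.

Lemma ler_norm_tanh (R : realType) (a : R) : `|tanh a| <= `|a|.
Proof.
wlog a0 : a / 0 <= a => [H|].
  by have [/H//|/ltW a0] := leP 0 a; rewrite -normrN -tanhN -(normrN a) H// oppr_ge0.
by rewrite !ger0_norm ?tanh_ge0// tanh_le.
Qed.

Lemma mulr_tanh_le (R : realType) (c y : R) : 0 <= c ->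
  tanh (c * y) * y <= c * y ^+ 2.
Proof.
move=> c0; apply: le_trans (ler_norm _) _; rewrite normrM.
apply: le_trans (ler_wpM2r _ (ler_norm_tanh _ _)) _ => //.
by rewrite normrM (ger0_norm c0) -mulrA -normrM ger0_norm -?expr2 ?sqr_ge0.
Qed.

(** * Rademacher chaos on the finite sign cube and its Gibbs weights *)

Section RademacherChaos.
Context {R : realType} {I : finType}.
Implicit Types (B : I -> I -> R) (x : {ffun I -> bool}) (i j : I).

(** The boolean [true] encodes the sign -1. Expectations over independent signs become unnormalised
    sums over all [x]. *)
Definition signs x i : R := (-1) ^+ x i.

Definition flip i x : {ffun I -> bool} :=
  [ffun j => if j == i then ~~ x j else x j].

Definition local_field B x i : R := \sum_j B i j * signs x j.

Definition chaos B x : R := \sum_i signs x i * local_field B x i.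

Lemma flipK i : involutive (flip i).
Proof.
by move=> x; apply/ffunP => j; rewrite !ffunE; case: eqP => // _; rewrite negbK.
Qed.

Lemma signs_flip i x j :
  signs (flip i x) j = if j == i then - signs x j else signs x j.
Proof.
by rewrite /signs ffunE; case: eqP => // _; case: (x j); rewrite ?expr0 ?expr1 ?opprK.
Qed.

Lemma sqr_signs x i : signs x i * signs x i = 1.
Proof. by rewrite /signs -expr2 sqrr_sign. Qed.

Lemma local_field_flip B i x j :
  local_field B (flip i x) j = local_field B x j - 2 * B j i * signs x i.
Proof.
rewrite /local_field (bigD1 i)//= [in RHS](bigD1 i)//= signs_flip eqxx.
rewrite (eq_bigr (fun k => B j k * signs x k)) => [|k ki].
  by rewrite mulrN; ring.
by rewrite signs_flip (negbTE ki).
Qed.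

(** By symmetry and the zero diagonal entry, the [i]-th sign occurs in the chaos only through the
    term [2 * signs x i * local_field B x i], which changes sign under the flip. *)
Lemma chaos_flip B i x : (forall i j, B i j = B j i) -> B i i = 0 ->
  chaos B (flip i x) = chaos B x - 4 * signs x i * local_field B x i.
Proof.
move=> Bsym Bii; rewrite /chaos.
under eq_bigr do rewrite local_field_flip mulrBr.
rewrite sumrB; have -> : \sum_j signs (flip i x) j * (2 * B j i * signs x i) =
    2 * signs x i * local_field B x i.
  rewrite /local_field mulr_sumr; apply: eq_bigr => j _.
  rewrite signs_flip Bsym; case: eqP => [->|_]; last by ring.
  by rewrite Bii; ring.
rewrite (bigD1 i)//= [in RHS](bigD1 i)//= signs_flip eqxx.
rewrite (eq_bigr (fun k => signs x k * local_field B x k)) => [|k ki].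
  by rewrite mulNr; ring.
by rewrite signs_flip (negbTE ki).
Qed.

(* The conditional law of the [i]-th sign under the weight [expR (c * chaos B x)]
   has mean [tanh (2 * c * local_field B x i)]. *)
Lemma sum_signs_expR_chaos B c i (h : {ffun I -> bool} -> R) :
  (forall i j, B i j = B j i) -> B i i = 0 ->
  (forall x, h (flip i x) = h x) ->
  \sum_x signs x i * h x * expR (c * chaos B x) =
  \sum_x tanh (2 * c * local_field B x i) * h x * expR (c * chaos B x).
Proof.
move=> Bsym Bii hi; apply/eqP; rewrite -subr_eq0 -sumrB.
(* The sum is doubled and one copy reindexed by the flip, so that each [x] is paired with
   [flip i x]; every pair cancels. *)
rewrite -[_ == 0](@mulrn_eq0 _ _ 2)/= mulr2n; apply/eqP.
rewrite [X in X + _](reindex_inj (inv_inj (flipK i))) -big_split/=.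
apply: big1 => x _; rewrite hi chaos_flip// local_field_flip Bii !mulr0 mul0r.
rewrite subr0 signs_flip eqxx; set y := local_field _ _ _.
set s := signs x i; set t := tanh _; set q := chaos _ _.
suff H : (s - t) * expR (c * q) = (s + t) * expR (c * (q - 4 * s * y)).
  transitivity (h x * ((s - t) * expR (c * q) - (s + t) * expR (c * (q - 4 * s * y)))).
    by ring.
  by rewrite H subrr mulr0.
(* The part [q - 2 * s * y] of the chaos is free of the [i]-th sign; factoring out its exponential
   leaves [tanh_eq]. *)
have -> : c * q = c * (q - 2 * s * y) + 2 * c * y * s by ring.
have -> : c * (q - 4 * s * y) = c * (q - 2 * s * y) - 2 * c * y * s by ring.
rewrite !expRD !(mulrCA _ (expR (c * (q - _)))); congr (_ * _).
rewrite /s /signs /t; set a := 2 * c * y.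
case: (x i); rewrite ?expr0 ?expr1 ?mulr1 ?mulrN1 ?opprK.
  transitivity (- ((1 + tanh a) * expR (- a))); first by ring.
  by rewrite -tanh_eq; ring.
exact: tanh_eq.
Qed.

(** The differential inequality for the moment generating function. Here [rho] stands for the
    spectral norm, through a bilinear bound for [u] dominated by [y], the shape met with [u] equal
    to [tanh (2 * c * y) / (2 * c)]. *)
Lemma sum_chaos_expR_le B c (v rho : R) :
  (forall i j, B i j = B j i) -> (forall i, B i i = 0) ->
  (\sum_i \sum_j B i j ^+ 2 <= v) ->
  (forall (y u : I -> R), (forall i, `|u i| <= `|y i|) ->
    \sum_i u i * (\sum_j B i j * y j) <= rho * \sum_i y i ^+ 2) ->
  0 < c -> 4 * c * rho <= 1 ->
  \sum_x chaos B x * expR (c * chaos B x) <=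
    4 * c * v * \sum_x expR (c * chaos B x).
Proof.
move=> Bsym Bii Bv Brho c0 crho.
set e := fun x => expR (c * chaos B x).
have e0 x : 0 <= e x by apply: expR_ge0.
set th := fun x i => tanh (2 * c * local_field B x i).
pose M := \sum_x (\sum_i local_field B x i ^+ 2) * e x.
have field_flip i x : local_field B (flip i x) i = local_field B x i.
  by rewrite local_field_flip Bii mulr0 mul0r subr0.
have step1 : \sum_x chaos B x * e x <= 2 * c * M.
  rewrite (_ : \sum_x _ = \sum_i \sum_x signs x i * local_field B x i * e x); last first.
    by rewrite exchange_big/=; apply: eq_bigr => x _; rewrite /chaos mulr_suml.
  under eq_bigr do rewrite sum_signs_expR_chaos//.
  rewrite exchange_big/= /M mulr_sumr; apply: ler_sum => x _.
  rewrite -mulr_suml mulrA; apply: ler_wpM2r; rewrite ?expR_ge0//.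
  rewrite mulr_sumr; apply: ler_sum => i _; apply: mulr_tanh_le.
  by rewrite mulr_ge0 ?ltW.
(* With [y = B x], [z] is [B y]. Its [i]-th entry contains the [i]-th sign with coefficient [cc i],
   the diagonal entry of the square of [B]; the remainder [r] does not see that sign, so the Gibbs
   identity applies to it. *)
pose z x i := \sum_j B i j * local_field B x j.
pose cc i := \sum_j B i j ^+ 2.
pose r x i := z x i - cc i * signs x i.
have r_flip i x : r (flip i x) i = r x i.
  rewrite /r /z signs_flip eqxx.
  under eq_bigr do rewrite local_field_flip mulrBr.
  rewrite sumrB; have -> : \sum_j B i j * (2 * B j i * signs x i) = 2 * cc i * signs x i.
    by rewrite /cc mulr_sumr mulr_suml; apply: eq_bigr => j _; rewrite (Bsym j i); ring.
  by ring.
have ME : M = \sum_i \sum_x signs x i * z x i * e x.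
  rewrite exchange_big/=; apply: eq_bigr => x _; rewrite -mulr_suml; congr (_ * _).
  transitivity (\sum_i \sum_j local_field B x i * B i j * signs x j).
    apply: eq_bigr => i _; rewrite expr2 {2}/local_field mulr_sumr.
    by apply: eq_bigr => j _; rewrite mulrA.
  rewrite exchange_big/=; apply: eq_bigr => j _; rewrite /z mulr_sumr.
  by apply: eq_bigr => i _; rewrite (Bsym j i); ring.
(* The dropped term [- cc i * \sum_x th x i ^+ 2 * e x] is nonpositive. *)
have coord i : \sum_x signs x i * z x i * e x <=
    cc i * \sum_x e x + \sum_x th x i * z x i * e x.
  have -> : \sum_x signs x i * z x i * e x =
      cc i * \sum_x e x + \sum_x signs x i * r x i * e x.
    rewrite mulr_sumr -big_split/=; apply: eq_bigr => x _.
    by rewrite /r -{2}(mul1r (e x)) -(sqr_signs x i); ring.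
  rewrite lerD2l sum_signs_expR_chaos//.
  have -> : \sum_x tanh (2 * c * local_field B x i) * r x i * expR (c * chaos B x) =
      \sum_x th x i * z x i * e x - cc i * \sum_x signs x i * th x i * e x.
    rewrite mulr_sumr -sumrB; apply: eq_bigr => x _.
    by rewrite /r -/(th x i) -/(e x); ring.
  rewrite lerBlDr lerDl; apply: mulr_ge0.
    by apply: sumr_ge0 => j _; exact: sqr_ge0.
  have -> : \sum_x signs x i * th x i * e x = \sum_x th x i * th x i * e x.
    apply: (sum_signs_expR_chaos _ _ _ (th^~ i)) => // x.
    by rewrite /th field_flip.
  by apply: sumr_ge0 => x _; rewrite mulr_ge0 ?expR_ge0// -expr2 sqr_ge0.
have step2 : M <= v * \sum_x e x + 2 * c * rho * M.
  rewrite {1}ME; apply: le_trans (ler_sum _ (fun i _ => coord i)) _.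
  rewrite big_split/= -mulr_suml lerD ?ler_wpM2r ?sumr_ge0//.
  rewrite exchange_big/= /M mulr_sumr; apply: ler_sum => x _.
  rewrite -mulr_suml mulrA; apply: ler_wpM2r => //.
  have c2 : 0 < 2 * c by rewrite mulr_gt0.
  (* Division by [2 * c] makes [th] dominated by the local field, as [Brho] requires. *)
  have -> : \sum_i th x i * z x i = 2 * c * \sum_i th x i / (2 * c) * z x i.
    rewrite mulr_sumr; apply: eq_bigr => i _.
    by field; rewrite gt_eqF.
  rewrite -[X in _ <= X]mulrA; apply: ler_wpM2l; first exact: ltW.
  apply: Brho => i; rewrite normrM normfV (gtr0_norm c2) ler_pdivrMr//.
  by rewrite mulrC -{1}(gtr0_norm c2) -normrM ler_norm_tanh.
have M0 : 0 <= M.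
  by apply: sumr_ge0 => x _; rewrite mulr_ge0// sumr_ge0// => i _; rewrite sqr_ge0.
(* Since [2 * c * rho] is at most one half, the [M] on the right of [step2] is absorbed at the cost
   of a factor 2. *)
have hM : M <= 2 * (v * \sum_x e x).
  have : 4 * c * rho * M <= 1 * M by rewrite ler_wpM2r.
  by move: step2; set S := v * _; lra.
apply: le_trans step1 _.
have -> : 4 * c * v * (\sum_x e x) = 2 * c * (2 * (v * \sum_x e x)) by ring.
by rewrite ler_wpM2l// mulr_ge0 ?ltW.
Qed.

End RademacherChaos.

(** * Moment generating function and tail counts of the chaos *)

Section RademacherChaosTail.
Context {R : realType} {I : finType}.
Variables (B : I -> I -> R) (v rho : R).
Hypotheses (Bsym : forall i j, B i j = B j i) (Bii : forall i, B i i = 0).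
Hypothesis Bv : \sum_i \sum_j B i j ^+ 2 <= v.
Hypothesis Brho : forall y u : I -> R, (forall i, `|u i| <= `|y i|) ->
  \sum_i u i * (\sum_j B i j * y j) <= rho * \sum_i y i ^+ 2.

(** Gronwall: by the differential inequality, [g l * expR (- (2 * v * l ^+ 2))] is nonincreasing on
    [[0, c]], and its value at 0 is the number of sign patterns. *)
Lemma mgf_chaos_le c : 0 <= c -> 4 * c * rho <= 1 ->
  \sum_(x : {ffun I -> bool}) expR (c * chaos B x) <=
  2 ^+ #|I| * expR (2 * v * c ^+ 2).
Proof.
move=> c0 crho.
pose g (l : R) := \sum_(x : {ffun I -> bool}) expR (l * chaos B x).
pose g' (l : R) := \sum_(x : {ffun I -> bool}) chaos B x * expR (l * chaos B x).
have dg (l : R) : is_derive l (1 : R) g (g' l).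
  rewrite /g /g' -fct_sumE; elim/big_ind2: _ => [|h1 h1' h2 h2' d1 d2|x _].
  - exact: is_derive_cst.
  - exact: is_deriveD.
  - have d1 : is_derive l (1 : R) (fun y : R => y * chaos B x) (chaos B x).
      by apply: is_derive_eq; rewrite /GRing.scale/=; ring.
    have := @is_derive1_comp R expR (fun y => y * chaos B x) l _ _ (is_derive_expR _) d1.
    by move=> h; apply: (is_derive_eq h); rewrite mulrC.
pose w (l : R) := expR (- (2 * v * l ^+ 2)).
have dw (l : R) : is_derive l (1 : R) w (- (4 * v * l) * w l).
  have d1 : is_derive l (1 : R) (fun y : R => - (2 * v * y ^+ 2)) (- (4 * v * l)).
    by apply: is_derive_eq; rewrite /GRing.scale/=; ring.
  have := @is_derive1_comp R expR _ l _ _ (is_derive_expR _) d1.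
  by move=> h; apply: (is_derive_eq h); rewrite mulrC.
have : - (g 0 * w 0) <= - (g c * w c).
  apply: (@ge0_is_derive_le _ (fun l => - (g l * w l))
     (fun l => (4 * l * v * g l - g' l) * w l)) => // l.
    by apply: is_derive_eq; rewrite /GRing.scale/=; ring.
  move=> /andP[l0 lc]; rewrite mulr_ge0 ?expR_ge0// subr_ge0.
  apply: (sum_chaos_expR_le _ _ _ rho) => //.
  (* The condition on [c] passes to smaller [l] by monotonicity if [rho] is nonnegative, and is
     trivial if [rho] is negative. *)
  have [r0|r0] := leP 0 rho.
    by apply: le_trans crho; rewrite ler_wpM2r// ler_wpM2l// ltW.
  by apply: (@le_trans _ _ 0); rewrite ?ler01// mulr_ge0_le0 ?ltW// mulr_gt0.
rewrite lerN2 /w expr0n/= mulr0 oppr0 expR0 mulr1 expRN ler_pdivrMr ?expR_gt0//.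
rewrite {2}/g (eq_bigr (fun=> 1)) => [|x _]; last by rewrite mul0r expR0.
by rewrite sumr_const card_ffun card_bool natrX.
Qed.

Lemma card_chaos_ge (eps : R) : 0 < eps -> 0 <= rho -> 0 < v ->
  #|[pred x : {ffun I -> bool} | eps <= chaos B x]|%:R <=
  2 ^+ #|I| * expR (- (eps ^+ 2 / (8 * v + 8 * eps * rho))).
Proof.
move=> e0 r0 v0.
have er0 : 0 <= eps * rho by rewrite mulr_ge0// ltW.
(* This [c] keeps [4 * c * rho <= 1] for every [eps] and makes [2 * v * c ^+ 2] at most half of
   [c * eps]; the other half is exactly the stated exponent. *)
pose c := eps / (4 * v + 4 * eps * rho).
have D0 : 0 < 4 * v + 4 * eps * rho by lra.
have c0 : 0 < c by rewrite divr_gt0.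
have crho : 4 * c * rho <= 1.
  rewrite [_ * rho](_ : _ = 4 * eps * rho / (4 * v + 4 * eps * rho)).
    by rewrite ler_pdivrMr//; lra.
  by rewrite /c; field; rewrite gt_eqF.
(* Exponential Markov inequality: each counted [x] contributes at least 1 to the right-hand side. *)
apply: (@le_trans _ _ (expR (- (c * eps)) *
    \sum_(x : {ffun I -> bool}) expR (c * chaos B x))).
  rewrite -sum1_card natr_sum mulr_sumr [leRHS](bigID (fun x => eps <= chaos B x))/=.
  rewrite -[leLHS]addr0 lerD//.
    apply: ler_sum => x ex; rewrite -expRD -(@expR0 R) ler_expR addrC -mulrBr.
    by rewrite mulr_ge0 ?subr_ge0// ltW.
  by apply: sumr_ge0 => x _; rewrite mulr_ge0 ?expR_ge0.
have := mgf_chaos_le _ (ltW c0) crho.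
move=> /(ler_wpM2l (expR_ge0 (- (c * eps)))) /le_trans; apply.
rewrite mulrCA ler_wpM2l ?exprn_ge0// -expRD ler_expR.
rewrite (_ : eps ^+ 2 / _ = c * eps / 2); last first.
  by rewrite /c; field; rewrite !gt_eqF//; lra.
suff : 2 * v * c ^+ 2 <= c * eps / 2 by lra.
rewrite (_ : 2 * v * _ = c * (2 * v * c)); last by ring.
rewrite -[leRHS]mulrA ler_pM2l// (_ : 2 * v * c = eps * (2 * v / (4 * v + 4 * eps * rho))).
  by rewrite ler_pM2l// ler_pdivrMr//; lra.
by rewrite /c; field; rewrite gt_eqF.
Qed.

End RademacherChaosTail.

Lemma chaosN {R : realType} {I : finType} (B : I -> I -> R) (x : {ffun I -> bool}) :
  chaos (fun i j => - B i j) x = - chaos B x.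
Proof.
rewrite /chaos -sumrN; apply: eq_bigr => i _; rewrite /local_field -mulrN -sumrN.
by congr (_ * _); apply: eq_bigr => j _; rewrite mulNr.
Qed.

(** The lower tail is the upper tail for [- B], which inherits the bilinear bound by replacing [u]
    with [- u]. *)
Lemma card_norm_chaos_ge {R : realType} {I : finType} (B : I -> I -> R) (v rho eps : R) :
  (forall i j, B i j = B j i) -> (forall i, B i i = 0) ->
  \sum_i \sum_j B i j ^+ 2 <= v ->
  (forall y u : I -> R, (forall i, `|u i| <= `|y i|) ->
    \sum_i u i * (\sum_j B i j * y j) <= rho * \sum_i y i ^+ 2) ->
  0 < eps -> 0 <= rho ->
  #|[pred x : {ffun I -> bool} | eps <= `|chaos B x|]|%:R <=
  2 ^+ #|I| * tail_bound v rho eps.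
Proof.
move=> Bsym Bii Bv Brho e0 r0.
have v_ge0 : 0 <= v.
  by apply: le_trans Bv; apply: sumr_ge0 => i _; apply: sumr_ge0 => j _; exact: sqr_ge0.
(* For [v = 0] the chaos vanishes identically and nothing is counted; this includes the case where
   [tail_bound] is read as 0. *)
have [v0|v_neq0] := eqVneq v 0.
  have B0 i j : B i j = 0.
    apply/eqP; rewrite -sqrf_eq0 eq_le sqr_ge0 andbT -v0; apply: le_trans Bv.
    rewrite (bigD1 i)//= (bigD1 j)//= -addrA lerDl addr_ge0// sumr_ge0// => k _.
      exact: sqr_ge0.
    by apply: sumr_ge0 => l _; exact: sqr_ge0.
  have t0 : 0 <= tail_bound v rho eps.
    by rewrite /tail_bound; case: ifP => // _; rewrite mulr_ge0 ?expR_ge0.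
  rewrite eq_card0 ?mulr_ge0 ?exprn_ge0// => x; rewrite inE /chaos big1 ?normr0 ?leNgt ?e0// => i _.
  by rewrite /local_field big1 ?mulr0// => j _; rewrite B0 mul0r.
have v0 : 0 < v by rewrite lt_def v_neq0.
rewrite /tail_bound (negbTE v_neq0)/= mulrCA mulrDl mul1r.
have h1 := card_chaos_ge _ _ _ Bsym Bii Bv Brho _ e0 r0 v0.
have h2 : #|[pred x : {ffun I -> bool} | eps <= chaos (fun i j => - B i j) x]|%:R <=
  2 ^+ #|I| * expR (- (eps ^+ 2 / (8 * v + 8 * eps * rho))).
  apply: card_chaos_ge => //.
  - by move=> i j; rewrite Bsym.
  - by move=> i; rewrite Bii oppr0.
  - by under eq_bigr do under eq_bigr do rewrite sqrrN.
  - move=> y u yu.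
    have -> : \sum_i u i * (\sum_j - B i j * y j) = \sum_i (- u i) * (\sum_j B i j * y j).
      apply: eq_bigr => i _; rewrite mulNr -mulrN -sumrN; congr (_ * _).
      by apply: eq_bigr => j _; rewrite mulNr.
    by apply: Brho => i; rewrite normrN.
apply: le_trans (lerD h1 h2); rewrite -natrD ler_nat.
rewrite -cardUI; apply: leq_trans (leq_addr _ _).
apply/subset_leq_card/fintype.subsetP => x; rewrite !inE chaosN => h.
by move: h; rewrite ler_normr.
Qed.

(** * Frobenius and spectral norms *)

Section SpectralNorm.
Context {R : realType}.

Lemma fnorm_ge0 m n (M : 'M[R]_(m, n)) : 0 <= fnorm M.
Proof. exact: sqrtr_ge0. Qed.

Lemma sqr_fnorm m n (M : 'M[R]_(m, n)) : fnorm M ^+ 2 = \sum_i \sum_j M i j ^+ 2.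
Proof.
by rewrite sqr_sqrtr//; apply: sumr_ge0 => i _; apply: sumr_ge0 => j _; exact: sqr_ge0.
Qed.

Lemma sqr_fnorm_col n (x : 'cV[R]_n) : fnorm x ^+ 2 = \sum_i x i 0 ^+ 2.
Proof. by rewrite sqr_fnorm; apply: eq_bigr => i _; rewrite big_ord1. Qed.

Lemma fnormZ m n (a : R) (M : 'M[R]_(m, n)) : fnorm (a *: M) = `|a| * fnorm M.
Proof.
apply: (@pexpIrn _ 2); rewrite ?nnegrE ?mulr_ge0 ?fnorm_ge0//.
rewrite exprMn real_normK ?num_real// !sqr_fnorm mulr_sumr; apply: eq_bigr => i _.
by rewrite mulr_sumr; apply: eq_bigr => j _; rewrite mxE exprMn.
Qed.

(** Bounds the set in [specnorm], so that its [sup] is a genuine supremum: entries of a vector in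
    the unit ball have absolute value at most 1. *)
Lemma fnorm_mulmx_bounded m n (M : 'M[R]_(m, n)) :
  exists C, forall x : 'cV[R]_n, fnorm x <= 1 -> fnorm (M *m x) <= C.
Proof.
exists (Num.sqrt (\sum_i (\sum_j `|M i j|) ^+ 2)) => x x1.
rewrite ler_wsqrtr//; apply: ler_sum => i _; rewrite big_ord1 mxE.
rewrite -(@real_normK _ (\sum_j _)) ?num_real//; apply: lerXn2r; rewrite ?nnegrE ?sumr_ge0//.
apply: le_trans (ler_norm_sum _ _ _) _; apply: ler_sum => j _.
rewrite normrM ler_piMr//; apply: le_trans x1.
rewrite -(@ler_pXn2r _ 2) ?nnegrE ?fnorm_ge0//.
rewrite real_normK ?num_real// sqr_fnorm_col (bigD1 j)//= lerDl sumr_ge0// => k _.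
exact: sqr_ge0.
Qed.

Lemma fnorm_mulmx_le_unit m n (M : 'M[R]_(m, n)) (x : 'cV[R]_n) :
  fnorm x <= 1 -> fnorm (M *m x) <= specnorm M.
Proof.
move=> x1; apply: ub_le_sup; last by exists x.
by have [C MC] := fnorm_mulmx_bounded _ _ M; exists C => _ [y /= y1 <-]; exact: MC.
Qed.

Lemma specnorm_ge0 m n (M : 'M[R]_(m, n)) : 0 <= specnorm M.
Proof.
apply: le_trans (fnorm_ge0 _ _ (M *m 0)) _; apply: fnorm_mulmx_le_unit.
by rewrite -(scale0r (0 : 'cV[R]_n)) fnormZ normr0 mul0r.
Qed.

Lemma fnorm_mulmx_le m n (M : 'M[R]_(m, n)) (x : 'cV[R]_n) :
  fnorm (M *m x) <= specnorm M * fnorm x.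
Proof.
have [x0|x_neq0] := eqVneq (fnorm x) 0.
  have -> : x = 0.
    apply/matrixP => i j; rewrite ord1 mxE; apply/eqP; rewrite -sqrf_eq0 eq_le sqr_ge0 andbT.
    rewrite -[leRHS](expr0n R 2) -x0 sqr_fnorm_col (bigD1 i)//= lerDl sumr_ge0// => k _.
    exact: sqr_ge0.
  by rewrite mulmx0 -(scale0r (0 : 'cV[R]_m)) fnormZ normr0 mul0r mulr_ge0 ?specnorm_ge0 ?fnorm_ge0.
have x0 : 0 < fnorm x by rewrite lt_def x_neq0 fnorm_ge0.
rewrite -ler_pdivrMr// -[leLHS]mulrC -(@ger0_norm _ (fnorm x)^-1) ?invr_ge0 ?fnorm_ge0//.
rewrite -fnormZ scalemxAr; apply: fnorm_mulmx_le_unit.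
by rewrite fnormZ ger0_norm ?invr_ge0 ?fnorm_ge0// mulVf.
Qed.

(** Cauchy-Schwarz by completing the square: with [s] the norm and [z = M y], the squares
    [(s * u i - z i) ^+ 2] give twice [s] times the left side at most [s ^+ 2] times the sum of the
    [u i ^+ 2] plus the sum of the [z i ^+ 2]. If [s = 0] then [z] vanishes. *)
Lemma bilinear_le_specnorm n (M : 'M[R]_n) (y u : 'I_n -> R) :
  (forall i, `|u i| <= `|y i|) ->
  \sum_i u i * (\sum_j M i j * y j) <= specnorm M * \sum_i y i ^+ 2.
Proof.
move=> uy; set s := specnorm M; pose Y : 'cV[R]_n := \col_i y i.
pose z i := \sum_j M i j * y j.
have s0 : 0 <= s by exact: specnorm_ge0.
have YE : \sum_i y i ^+ 2 = fnorm Y ^+ 2.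
  by rewrite sqr_fnorm_col; apply: eq_bigr => i _; rewrite mxE.
have zE : \sum_i z i ^+ 2 = fnorm (M *m Y) ^+ 2.
  rewrite sqr_fnorm_col; apply: eq_bigr => i _; rewrite mxE.
  by congr (_ ^+ 2); apply: eq_bigr => j _; rewrite mxE.
have zle : \sum_i z i ^+ 2 <= s ^+ 2 * \sum_i y i ^+ 2.
  rewrite zE YE -exprMn lerXn2r ?nnegrE ?mulr_ge0 ?fnorm_ge0//.
  exact: fnorm_mulmx_le.
have y2 : 0 <= \sum_i y i ^+ 2 by rewrite YE exprn_ge0// fnorm_ge0.
have ule : \sum_i u i ^+ 2 <= \sum_i y i ^+ 2.
  apply: ler_sum => i _; rewrite -[leLHS]real_normK ?num_real//.
  by rewrite -[leRHS]real_normK ?num_real// lerXn2r ?nnegrE.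
have [s_eq0|s_neq0] := eqVneq s 0.
  move: zle; rewrite s_eq0 expr0n/= mul0r => zle.
  rewrite big1// => i _; have -> : \sum_j M i j * y j = 0; last by rewrite mulr0.
  apply/eqP; rewrite -sqrf_eq0 eq_le sqr_ge0 andbT; apply: le_trans zle.
  by rewrite [leRHS](bigD1 i)//= lerDl sumr_ge0// => k _; exact: sqr_ge0.
have {s_neq0} s_gt0 : 0 < s by rewrite lt_def s_neq0.
rewrite -(ler_pM2l (mulr_gt0 (ltr0n R 2) s_gt0))//.
apply: (@le_trans _ _ (s ^+ 2 * \sum_i u i ^+ 2 + \sum_i z i ^+ 2)).
  rewrite !mulr_sumr -big_split/=; apply: ler_sum => i _; rewrite -/(z i) -subr_ge0.
  by rewrite (_ : _ - _ = (s * u i - z i) ^+ 2) ?sqr_ge0//; ring.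
have := ler_wpM2l (sqr_ge0 s) ule; move: zle; set a := \sum_i z i ^+ 2.
rewrite mulrA (_ : 2 * s * s = s ^+ 2 + s ^+ 2); last by ring.
by rewrite mulrDl => h1 h2; apply: lerD.
Qed.

End SpectralNorm.

(** * The block diagonal coefficient matrix of all samples *)

Section BlockChaos.
Context {R : realType} {n : nat} {K : finType}.
Variables (F : 'M[R]_n) (C : K -> {set 'I_n}) (c : K -> R).

(** One coordinate per sample and position in its class: samples with equal classes keep separate
    coordinates, since their signs are independent. *)
Definition block_index : finType := {k : K & 'I_#|C k|}.

Definition block_pos k (a : 'I_#|C k|) : block_index := Tagged (fun k => 'I_#|C k|) a.

Definition block_coef (p q : block_index) : R :=
  if (tag p == tag q) && (p != q) then
    c (tag p) * F (enum_val (tagged p)) (enum_val (tagged q))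
  else 0.

Local Notation offC k := (offdiag (principal_submx F (C k))).

Lemma sum_block_index (g : block_index -> R) :
  \sum_p g p = \sum_k \sum_(a < #|C k|) g (block_pos k a).
Proof.
by rewrite [RHS]sig_big_dep/=; apply: eq_bigr => -[k a] _.
Qed.

Lemma block_coef_pos k a b :
  block_coef (block_pos k a) (block_pos k b) = c k * offC k a b.
Proof.
rewrite /block_coef /= eqxx /= eq_Tagged !mxE.
by case: eqP => _ //=; rewrite ?mulr0 ?mxE.
Qed.

(** Other blocks have coefficient 0, where [g] vanishes. The general [g] serves both squares and
    products with a vector. *)
Lemma sum_block_coef k a (g : block_index -> R -> R) : (forall q, g q 0 = 0) ->
  \sum_q g q (block_coef (block_pos k a) q) =
  \sum_(b < #|C k|) g (block_pos k b) (c k * offC k a b).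
Proof.
move=> g0; rewrite sum_block_index (bigD1 k)//= [X in _ + X]big1 ?addr0.
  by apply: eq_bigr => b _; rewrite block_coef_pos.
move=> k' k'k; apply: big1 => b _; rewrite /block_coef/= eq_sym (negbTE k'k)/=.
exact: g0.
Qed.

Lemma block_coef_sym : F^T = F -> forall p q, block_coef p q = block_coef q p.
Proof.
move=> Fsym p q; rewrite /block_coef (eq_sym (tag p)) (eq_sym p).
case: ifP => // /andP[/eqP tqp _]; have -> : c (tag p) = c (tag q) by rewrite tqp.
by rewrite -[in LHS]Fsym mxE.
Qed.

Lemma block_coef_diag p : block_coef p p = 0.
Proof. by rewrite /block_coef !eqxx. Qed.

Lemma sum_sqr_block_coef :
  \sum_p \sum_q block_coef p q ^+ 2 = \sum_k c k ^+ 2 * fnorm (offC k) ^+ 2.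
Proof.
rewrite sum_block_index; apply: eq_bigr => k _; rewrite sqr_fnorm mulr_sumr.
apply: eq_bigr => a _; rewrite (sum_block_coef _ _ (fun=> fun r => r ^+ 2)) ?expr0n//.
by rewrite mulr_sumr; apply: eq_bigr => b _; rewrite exprMn.
Qed.

(** A block diagonal form splits into its blocks, and domination of [u] by [y] restricts to each of
    them. *)
Lemma block_coef_bilinear_le (rho : R) (y u : block_index -> R) :
  (forall k, 0 <= c k) -> (forall k, c k * specnorm (offC k) <= rho) ->
  (forall p, `|u p| <= `|y p|) ->
  \sum_p u p * (\sum_q block_coef p q * y q) <= rho * \sum_p y p ^+ 2.
Proof.
move=> c0 crho uy; rewrite !sum_block_index mulr_sumr; apply: ler_sum => k _.
pose yk a := y (block_pos k a); pose uk a := u (block_pos k a).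
apply: (@le_trans _ _ (c k * (specnorm (offC k) * \sum_a yk a ^+ 2))); last first.
  by rewrite mulrA ler_wpM2r// sumr_ge0// => a _; exact: sqr_ge0.
have := @bilinear_le_specnorm R _ (offC k) yk uk (fun a => uy _).
move=> /(ler_wpM2l (c0 k)); apply: le_trans; rewrite mulr_sumr le_eqVlt.
apply/orP; left; apply/eqP; apply: eq_bigr => a _; rewrite mulrCA; congr (_ * _).
rewrite (sum_block_coef _ _ (fun q r => r * y q)) => [|q]; last by rewrite mul0r.
by rewrite mulr_sumr; apply: eq_bigr => b _; rewrite mulrA.
Qed.

Lemma chaos_block_coef x :
  chaos block_coef x = \sum_k c k *
    \sum_(a < #|C k|) \sum_(b < #|C k|)
      signs x (block_pos k a) * offC k a b * signs x (block_pos k b) :> R.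
Proof.
rewrite /chaos sum_block_index; apply: eq_bigr => k _; rewrite mulr_sumr.
apply: eq_bigr => a _; rewrite /local_field.
rewrite (sum_block_coef _ _ (fun q r => r * signs x q)) => [|q]; last by rewrite mul0r.
by rewrite !mulr_sumr; apply: eq_bigr => b _; ring.
Qed.

End BlockChaos.

Lemma quadratic_form_delta {R : realType} {n r : nat} (F : 'M[R]_n)
    (e : 'I_r -> 'I_n) (s : 'I_r -> R) :
  let w : 'cV[R]_n := \sum_a s a *: delta_mx (e a) 0 in
  (w^T *m F *m w) 0 0 = \sum_a \sum_b s a * F (e a) (e b) * s b.
Proof.
move=> w; rewrite {2}/w mulmx_sumr summxE exchange_big/=; apply: eq_bigr => b _.
rewrite -scalemxAr mxE -colE mxE mulrC -mulr_suml; congr (_ * _).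
rewrite /w linear_sum/= mulmx_suml summxE; apply: eq_bigr => a _.
by rewrite linearZ/= -scalemxAl mxE trmx_delta -rowE mxE.
Qed.

(** Signs square to 1, so the diagonal contribution is deterministic. *)
Lemma quadratic_form_offdiag {R : realType} {n : nat} (F : 'M[R]_n)
    (C : {set 'I_n}) (s : 'I_#|C| -> R) (w : 'cV[R]_n) :
  (forall a, s a * s a = 1) -> w = \sum_a s a *: delta_mx (enum_val a) 0 ->
  (w^T *m F *m w) 0 0 = \sum_(i in C) F i i +
    \sum_a \sum_b s a * offdiag (principal_submx F C) a b * s b.
Proof.
move=> s1 ->; rewrite quadratic_form_delta.
have -> : \sum_(i in C) F i i = \sum_(a < #|C|) F (enum_val a) (enum_val a).
  by rewrite big_enum_val.
rewrite -big_split/=.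
apply: eq_bigr => a _; rewrite (bigD1 a)//= [in RHS](bigD1 a)//= !mxE eqxx.
rewrite mulr0 mul0r add0r mulrAC s1 mul1r; congr (_ + _); apply: eq_bigr => b ba.
by rewrite !mxE eq_sym (negbTE ba).
Qed.

(** * From probabilities to counting sign patterns *)

Lemma sigma_algebra_fin_bigcap {T : Type} {G : set (set T)} {J : finType}
    (D : {set J}) (E : J -> set T) : sigma_algebra setT G ->
  (forall i, i \in D -> G (E i)) -> G (\bigcap_(i in [set` D]) E i).
Proof.
move=> [G0 GC GU] GE; rewrite -[X in G X]setCK -setTD; apply: (GC).
rewrite setC_bigcap.
(* The finite family of complements, listed by rank and padded with the empty set, becomes a
   sequence. *)
pose H m := if [pick i in D | enum_rank i == m :> nat] is Some i then ~` E i else set0.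
have -> : \bigcup_(i in [set` D]) ~` E i = \bigcup_m H m.
  apply/seteqP; split=> [t [i /= iD Et]|t [m _]]; last first.
    by rewrite /H; case: pickP => // i /andP[iD _] ?; exists i.
  exists (enum_rank i) => //; rewrite /H.
  case: pickP => [j /andP[jD /eqP/val_inj/enum_rank_inj ->]//|].
  by move=> /(_ i); rewrite iD eqxx.
apply: (GU) => m; rewrite /H; case: pickP => // i /andP[iD _].
by rewrite -setTD; apply: GC; exact: GE.
Qed.

(** [E] is disjoint from every [A x] with [x] not bad, so their masses and that of [E] add up to at
    most 1. Whatever lies outside all the [A x] is a null set. *)
Lemma probability_le_card {R : realType} {dsp : measure_display}
    {T : measurableType dsp} (P : probability T R) (X : finType) (A : X -> set T)
    (E : set T) (bad : pred X) :
  (0 < #|X|)%N ->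
  (forall x, measurable (A x)) -> trivIset setT A ->
  (forall x, P (A x) = (#|X|%:R^-1)%:E) -> measurable E ->
  (forall x t, A x t -> E t -> bad x) ->
  (P E <= (#|X|%:R^-1 * #|bad|%:R)%:E)%E.
Proof.
move=> X0 mA tA PA mE Ebad; pose good := [pred x | ~~ bad x].
pose U := \bigcup_(x in [set` enum good]) A x.
have Ufin : finite_set [set` enum good] by exact: finite_seq.
have mU : measurable U by exact: fin_bigcup_measurable.
have PU : P U = (#|X|%:R^-1 * #|good|%:R)%:E.
  rewrite /U measure_fin_bigcup//; last exact: sub_trivIset tA.
  rewrite -fsbig_seq ?enum_uniq// (eq_bigr _ (fun x _ => PA x)) sumEFin.
  by rewrite big_enum/= sumr_const mulr_natr.
have EU : E `&` U = set0.
  apply/seteqP; split=> // t [Et [x /=]]; rewrite mem_enum inE => /negP nb Axt.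
  by apply: nb; apply: Ebad Et.
have := probability_le1 P (measurableU _ _ mE mU).
have -> : P (E `|` U) = (P E + P U)%E by rewrite measureU.
rewrite PU -(fineK (fin_num_measure P E mE)) -EFinD !lee_fin => PEU.
have X0' : (#|X|%:R : R) != 0 by rewrite pnatr_eq0 -lt0n.
rewrite -(lerD2r (#|X|%:R^-1 * #|good|%:R)); apply: le_trans PEU _.
by rewrite -mulrDr -natrD cardC mulVf.
Qed.

(** * Cylinders fixing all the signs *)

Section SignCylinders.
Context {R : realType} {dsp : measure_display} {T : measurableType dsp}.
Context {n : nat} {K : finType}.
Variables (P : probability T R) (C : K -> {set 'I_n}).
Variables (w : K -> T -> 'cV[R]_n) (X : K -> 'I_n -> {RV P >-> R}).
Hypothesis X_rademacher : forall k i, i \in C k -> rademacher (X k i).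
Hypothesis X_indep : forall k,
  mutually_independent P (C k) (fun i => sigma_rv (X k i)).
Hypothesis wE : forall k t, w k t = \sum_(i in C k) X k i t *: delta_mx i 0.
Hypothesis w_indep :
  mutually_independent P [set: K]%SET (fun k => sigma_rvec (w k)).

(* [signs x] is indexed by positions in the block, hence the quantification over
   the (unique, for [i] in [C k]) position [a] of [i]. *)
Definition sign_event (x : {ffun block_index C -> bool}) k (i : 'I_n) : set T :=
  [set t | forall a : 'I_#|C k|, enum_val a = i -> X k i t = signs x (block_pos C k a)].

Definition sign_cylinder (x : {ffun block_index C -> bool}) : set T :=
  \bigcap_(k in [set` [set: K]%SET]) \bigcap_(i in [set` C k]) sign_event x k i.

Lemma sign_event_enum_val x k a :
  sign_event x k (enum_val a) = X k (enum_val a) @^-1` [set signs x (block_pos C k a)].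
Proof.
by apply/seteqP; split=> t /= h => [|b /enum_val_inj->//]; exact: h.
Qed.

Lemma sign_event_preimage x k i : i \in C k ->
  exists r, sign_event x k i = X k i @^-1` [set r].
Proof.
move=> iC; rewrite -(enum_rankK_in iC iC) sign_event_enum_val.
by eexists.
Qed.

Lemma probing_coord k t i : i \in C k -> w k t i 0 = X k i t.
Proof.
move=> iC; rewrite wE summxE (bigD1 i)//= !mxE !eqxx mulr1 big1 ?addr0// => j /andP[_ ji].
by rewrite !mxE eq_sym (negbTE ji) mulr0.
Qed.

Lemma measurable_sign_cylinder x : measurable (sign_cylinder x).
Proof.
apply: fin_bigcap_measurable => // k _; apply: fin_bigcap_measurable => // i iC.
have [r ->] := sign_event_preimage x k i iC.
by rewrite -[X in measurable X]setTI; exact: measurable_funP.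
Qed.

Lemma sign_cylinder_coord x t k a :
  sign_cylinder x t -> X k (enum_val a) t = signs x (block_pos C k a).
Proof.
move=> /(_ k) /(_ (finset.in_setT k)) /(_ _ (enum_valP a)).
by rewrite sign_event_enum_val.
Qed.

Lemma trivIset_sign_cylinder : trivIset setT sign_cylinder.
Proof.
apply/trivIsetP => x y _ _ xy; apply/seteqP; split=> // t [Ax Ay].
apply/negP: xy; rewrite negbK; apply/eqP/ffunP => -[k a].
have := sign_cylinder_coord x t k a Ax; rewrite (sign_cylinder_coord y t k a Ay).
rewrite /signs /block_pos /Tagged; case: (x _) (y _) => -[]//; rewrite expr0 expr1 => /eqP.
  by rewrite -subr_eq0 opprK (pnatr_eq0 R 2).
by rewrite eq_sym -subr_eq0 opprK (pnatr_eq0 R 2).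
Qed.

Lemma probability_sign_event x k i : i \in C k -> P (sign_event x k i) = (2^-1)%:E.
Proof.
move=> iC; have [P1 PN1] := X_rademacher _ _ iC.
rewrite -(enum_rankK_in iC iC) in P1 PN1 *; rewrite sign_event_enum_val /signs.
by case: (x _); rewrite ?expr0 ?expr1.
Qed.

(** Independence is used twice: between probing vectors, then among the entries of one vector. Each
    coordinate of [block_index] contributes a factor one half. *)
Lemma probability_sign_cylinder x :
  P (sign_cylinder x) = (#|{ffun block_index C -> bool}|%:R^-1)%:E.
Proof.
rewrite /sign_cylinder w_indep//; last first.
  (* The sign events of sample [k] belong to the sigma-algebra of its vector, whose coordinates on
     [C k] are the [X k i]. *)
  move=> k _; rewrite /sigma_rvec; apply: sigma_algebra_fin_bigcap.
    exact: smallest_sigma_algebra.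
  move=> i iC; apply: sub_sigma_algebra; exists i => //.
  have [r ->] := sign_event_preimage x k i iC.
  exists [set r]; first exact: measurable_set1.
  by rewrite setTI; apply/seteqP; split=> t /=; rewrite probing_coord.
transitivity (\prod_k \prod_(i in C k) (2^-1 : R)%:E)%E.
  apply: eq_big => [k|k _]; first by rewrite inE.
  rewrite (X_indep k)//; last first.
    move=> i iC; have [r ->] := sign_event_preimage x k i iC.
    by exists [set r]; [exact: measurable_set1|rewrite setTI].
  by apply: eq_bigr => i iC; exact: probability_sign_event.
under eq_bigr do rewrite prodEFin big_enum_val.
by rewrite prodEFin sig_big_dep/= prodr_const card_ffun card_bool exprVn natrX.
Qed.

End SignCylinders.

Lemma trmx_matfun {R : realType} {n : nat} (f : R -> R) (A : 'M[R]_n) :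
  A^T = A -> (matfun f A)^T = matfun f A.
Proof.
move=> /ex_spectral_decomposition[U [lam AE]]; rewrite (matfunE f AE).
by rewrite !trmx_mul trmxK tr_diag_mx mulmxA.
Qed.

(** * The estimator as trace plus chaos *)

Section ProbingEstimator.
Context {R : realType} {n m : nat}.
Variables (F : 'M[R]_n) (col : 'I_n -> 'I_m) (N : 'I_m -> nat).
Hypothesis N_gt0 : forall l, (0 < N l)%N.

Local Notation K := {l : 'I_m & 'I_(N l)}.

Let C (k : K) := color_class col (tag k).
Let c (k : K) : R := (N (tag k))%:R^-1.
Local Notation offC l := (offdiag (principal_submx F (color_class col l))).

Lemma sum_samples (h : 'I_m -> R) :
  \sum_(k : K) h (tag k) = \sum_l (N l)%:R * h l.
Proof.
transitivity (\sum_l \sum_(s < N l) h l); first by rewrite sig_big_dep.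
by apply: eq_bigr => l _; rewrite sumr_const card_ord mulr_natl.
Qed.

Lemma mxtrace_color : \tr F = \sum_l \sum_(i in color_class col l) F i i.
Proof.
rewrite /mxtrace (partition_big col xpredT)//=.
by apply: eq_bigr => l _; apply: eq_bigl => i; rewrite inE.
Qed.

Lemma samples_neq0 l : (N l)%:R != 0 :> R.
Proof. by rewrite pnatr_eq0 -lt0n. Qed.

(** Color [l] owns [N l] blocks, each scaled by the square of the inverse of [N l]; one inverse
    factor survives, as in [eta1]. *)
Lemma sum_sqr_probing_coef :
  \sum_p \sum_q block_coef F C c p q ^+ 2 = eta1 N col F.
Proof.
rewrite sum_sqr_block_coef (sum_samples (fun l => (N l)%:R^-1 ^+ 2 * fnorm (offC l) ^+ 2)).
apply: eq_bigr => l _; rewrite mulrA; congr (_ * _).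
by rewrite expr2 mulrA mulfV ?mul1r// samples_neq0.
Qed.

(** The diagonal sums of the classes, averaged over samples and added over colors, give the trace;
    the off-diagonal parts form the chaos. *)
Lemma probing_estimator_chaos (w : forall l : 'I_m, 'I_(N l) -> 'cV[R]_n)
    (x : {ffun block_index C -> bool}) :
  (forall k : K, w (tag k) (tagged k) =
     \sum_a signs x (block_pos C k a) *: delta_mx (enum_val a) 0) ->
  probing_estimator F w = \tr F + chaos (block_coef F C c) x.
Proof.
move=> wE; rewrite chaos_block_coef.
transitivity (\sum_(k : K) c k *
    ((w (tag k) (tagged k))^T *m F *m w (tag k) (tagged k)) 0 0).
  rewrite -(@sig_big_dep _ _ _ _ (fun l => 'I_(N l)) xpredT (fun=> xpredT)
    (fun l s => (N l)%:R^-1 * ((w l s)^T *m F *m w l s) 0 0))/=.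
  by apply: eq_bigr => l _; rewrite mulr_sumr.
under eq_bigr => k _.
  rewrite (quadratic_form_offdiag _ _ _ _ (fun a => sqr_signs x (block_pos C k a)) (wE k)).
  rewrite mulrDr; over.
rewrite big_split/=; congr (_ + _).
rewrite (sum_samples (fun l => (N l)%:R^-1 * \sum_(i in color_class col l) F i i)).
rewrite mxtrace_color; apply: eq_bigr => l _.
by rewrite mulrA mulfV ?mul1r// samples_neq0.
Qed.

Lemma measurable_probing_estimator {dsp : measure_display} {T : measurableType dsp}
    (w : forall l : 'I_m, 'I_(N l) -> T -> 'cV[R]_n) :
  (forall l s i, measurable_fun setT (fun t => w l s t i 0)) ->
  measurable_fun setT (fun t => probing_estimator F (fun l s => w l s t)).
Proof.
move=> mw; apply: measurable_sum => l; apply: measurable_funM; first exact: measurable_cst.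
apply: measurable_sum => s.
have -> : (fun t => ((w l s t)^T *m F *m w l s t) 0 0) =
    (fun t => \sum_j (\sum_i w l s t i 0 * F i j) * w l s t j 0).
  apply/funext => t; rewrite mxE; apply: eq_bigr => j _; rewrite mxE; congr (_ * _).
  by apply: eq_bigr => i _; rewrite mxE.
apply: measurable_sum => j; apply: measurable_funM => //.
by apply: measurable_sum => i; apply: measurable_funM => //; exact: measurable_cst.
Qed.

End ProbingEstimator.

(** * The deviation bound and the sample size condition *)

Lemma tail_bound_le {R : realType} (eta1 eta2 eps delta : R) :
  0 <= eta1 -> 0 <= eta2 -> 0 < eps -> 0 < delta < 1 ->
  eta1 + eps * eta2 <= eps ^+ 2 / (8 * ln (2 / delta)) ->
  tail_bound eta1 eta2 eps <= delta.
Proof.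
move=> eta10 eta20 e0 /andP[d0 d1] h; rewrite /tail_bound.
case: ifPn => [_|eta_neq0]; first exact: ltW.
have D0 : 0 < 8 * eta1 + 8 * eps * eta2.
  have e2 : 0 <= eps * eta2 by rewrite mulr_ge0// ltW.
  suff : eta1 + eps * eta2 != 0.
    by move=> s0; have : 0 < eta1 + eps * eta2; [rewrite lt_def s0 addr_ge0|lra].
  rewrite paddr_eq0// mulf_eq0 (gt_eqF e0)/=; exact: eta_neq0.
have d2 : 1 < 2 / delta by rewrite ltr_pdivlMr//; lra.
have l0 : 0 < ln (2 / delta) by rewrite ln_gt0.
rewrite -ler_pdivlMl//.
(* Writing half of [delta] as an exponential reduces the claim to comparing exponents, which is [h]
   with denominators cleared. *)
have -> : 2^-1 * delta = expR (- ln (2 / delta)).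
  by rewrite expRN lnK ?posrE ?divr_gt0// invf_div mulrC.
rewrite ler_expR lerN2 ler_pdivlMr// mulrC.
move: h; rewrite ler_pdivlMr ?mulr_gt0//.
by apply: le_trans; rewrite le_eqVlt; apply/orP; left; apply/eqP; ring.
Qed.

Theorem theorem3p8 (R : realType) (n : nat) (A : 'M[R]_n) (f : R -> R)
  (d m : nat) (col : 'I_n -> 'I_m) (N : 'I_m -> nat)
  (dsp : measure_display) (T : measurableType dsp) (P : probability T R)
  (w : forall l : 'I_m, 'I_(N l) -> T -> 'cV[R]_n)
  (A_sym : A^T = A)
  (fA_neq0 : matfun f A != 0)
  (d_ge1 : (1 <= d)%N)
  (col_dist : distance_coloring A d col)
  (N_gt0 : forall l, (0 < N l)%N)
  (w_rademacher : forall l (s : 'I_(N l)),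
     rademacher_probing P (color_class col l) (w l s))
  (w_indep : mutually_independent P [set: {l : 'I_m & 'I_(N l)}]%SET
     (fun k => sigma_rvec (w (tag k) (tagged k)))) :
  let F := matfun f A in
  let err (t : T) := `|\tr F - probing_estimator F (fun l s => w l s t)| in
  let eta1 := eta1 N col F in
  let eta2 := eta2 N col F in
  forall eps : R, 0 < eps ->
    (P [set t | (eps <= err t)%R] <= (tail_bound eta1 eta2 eps)%:E)%E /\
    (forall delta : R, 0 < delta < 1 ->
       eta1 + eps * eta2 <= eps ^+ 2 / (8 * ln (2 / delta)) ->
       (P [set t | (eps <= err t)%R] <= delta%:E)%E).
Proof.
move=> F err e1 e2 eps eps0.
have Fsym : F^T = F by exact: trmx_matfun.
pose K := {l : 'I_m & 'I_(N l)}.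
pose C (k : K) := color_class col (tag k).
pose c (k : K) : R := (N (tag k))%:R^-1.
(* The scalar signs behind each probing vector are chosen simultaneously for all samples. *)
have [X XP] := choice (fun k : K => w_rademacher (tag k) (tagged k)).
have X_rad k i : i \in C k -> rademacher (X k i) by have [h _ _] := XP k; exact: h.
have X_ind k : mutually_independent P (C k) (fun i => sigma_rv (X k i)).
  by have [] := XP k.
pose wK (k : K) := w (tag k) (tagged k).
have wE k t : wK k t = \sum_(i in C k) X k i t *: delta_mx i 0.
  by have [_ _ h] := XP k; exact: h.
have c0 k : 0 <= c k by rewrite invr_ge0.
have e2_ge l : (N l)%:R^-1 * specnorm (offdiag (principal_submx F (color_class col l))) <= e2.
  exact: (le_bigmax _ (fun l =>
    (N l)%:R^-1 * specnorm (offdiag (principal_submx F (color_class col l))))).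
have e2_ge0 : 0 <= e2 by exact: bigmax_ge_id.
have e1_ge0 : 0 <= e1.
  by apply: sumr_ge0 => l _; rewrite mulr_ge0 ?invr_ge0// exprn_ge0// fnorm_ge0.
suff bound : (P [set t | (eps <= err t)%R] <= (tail_bound e1 e2 eps)%:E)%E.
  split=> // delta d01 h; apply: le_trans bound _; rewrite lee_fin.
  exact: tail_bound_le.
have mw l s i : measurable_fun setT (fun t => w l s t i 0).
  have -> : (fun t => w l s t i 0) =
      (fun t => \sum_(j in C (Tagged (fun l => 'I_(N l)) s))
         X (Tagged _ s) j t * delta_mx j (0 : 'I_1) i 0).
    apply/funext => t; rewrite -[w l s]/(wK (Tagged _ s)) wE summxE.
    by apply: eq_bigr => j _; rewrite mxE.
  under eq_fun do rewrite -big_enum/=.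
  by apply: measurable_sum => j; apply: measurable_funM => //; exact: measurable_cst.
have merr : measurable [set t | (eps <= err t)%R].
  rewrite -[X in measurable X]setTI -[X in setT `&` X]/(err @^-1` [set r | eps <= r]).
  have -> : [set r | eps <= r] = `[eps, +oo[%classic.
    by apply/seteqP; split=> r /=; rewrite in_itv/= andbT.
  have : measurable_fun setT err; last by apply; [exact: measurableT|exact: measurable_itv].
  apply: measurableT_comp => //; apply: measurable_funB; first exact: measurable_cst.
  exact: measurable_probing_estimator.
(* On a cylinder all signs are fixed, so the error takes a single value there. *)
have err_chaos (x : {ffun block_index C -> bool}) t :
    sign_cylinder P C X x t -> err t = `|chaos (block_coef F C c) x|.
  move=> Axt; rewrite /err (probing_estimator_chaos _ _ _ N_gt0 _ x).
    by rewrite opprD addNKr normrN.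
  move=> k; rewrite -/(wK k t) wE big_enum_val; apply: eq_bigr => a _.
  by rewrite (sign_cylinder_coord _ _ _ x).
have := @probability_le_card R dsp T P _ (sign_cylinder P C X) _
  [pred x | eps <= `|chaos (block_coef F C c) x|] _ (measurable_sign_cylinder P C X)
  (trivIset_sign_cylinder P C X)
  (probability_sign_cylinder P C wK X X_rad X_ind wE w_indep) merr.
move=> /(_ _ _)/le_trans; apply.
- by apply/card_gt0P; exists [ffun=> true].
- by move=> x t Axt /=; rewrite (err_chaos x).
(* Multiplying by the number of sign patterns leaves the counting bound for the chaos. *)
rewrite lee_fin card_ffun card_bool natrX ler_pdivrMl ?exprn_gt0//.
apply: card_norm_chaos_ge => //.
- exact: block_coef_sym.
- exact: block_coef_diag.
- by rewrite sum_sqr_probing_coef.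
- by move=> y u uy; apply: block_coef_bilinear_le => // k; exact: e2_ge.
Qed.
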